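(* Assume that $a>2$ and let $m\ge1$ be an integer. If $B\in\mathcal K_m(a)$ attains $\gamma_m(a)$, i.e. $\lambda_{\max}(B)=\gamma_m(a)$, then there exists a permutation $\pi$ of $[m]$ such that, with $U_r:=\{\pi(1),\dots,\pi(r)\}$ for $r=1,\dots,m$, we have $$\mathcal I_{U_r}(B)=r\qquad\text{for all }r=1,\dots,m.$$
   Context: For $a>0$, an integer $m\ge1$, a real symmetric $m\times m$ matrix $B$ and $U\subset[m]=\{1,\dots,m\}$, put $$\mathcal I_U(B)=\mathcal I_{U,a}(B):=\frac1a\sum_{i\in U}B_{ii}^2+\sum_{i<j,\ i,j\in U}B_{ij}^2,$$ $$\mathcal K_m(a):=\{B=B^\top\in\mathbb R^{m\times m}:\ \mathcal I_{U,a}(B)\le|U|\text{ for every }\varnothing\ne U\subset[m]\},$$ and $\gamma_m(a):=\max_{B\in\mathcal K_m(a)}\lambda_{\max}(B)$ (the maximum exists since $\mathcal K_m(a)$ is compact). *)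

(* Defs.v *)
From mathcomp Require Import all_boot all_order all_algebra perm.
From mathcomp Require Import classical_sets reals.

Set Implicit Arguments.
Unset Strict Implicit.
Unset Printing Implicit Defensive.

Import Order.TTheory GRing.Theory Num.Theory.
Local Open Scope ring_scope.

Definition calI (R : realType) (m : nat) (a : R) (U : {set 'I_m})
    (B : 'M[R]_m) : R :=
  1 / a * \sum_(i in U) B i i ^+ 2
  + \sum_(i in U) \sum_(j in U | (i < j)%N) B i j ^+ 2.

Definition calK (R : realType) (m : nat) (a : R) : set 'M[R]_m :=
  [set B : 'M[R]_m | B = B^T /\
     forall U : {set 'I_m}, U != finset.set0 -> calI a U B <= #|U|%:R]%classic.
Arguments calK {R} m a _.

(* For symmetric B and m >= 1 the set of eigenvalues is finite and nonempty,
   so this supremum is the largest eigenvalue.  [eigenvalue] refers to row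
   eigenvectors; a square matrix and its transpose have the same spectrum. *)
Definition lambda_max (R : realType) (m : nat) (B : 'M[R]_m) : R :=
  sup [set x : R | eigenvalue B x]%classic.

(* For a > 0 and m >= 1, calK m a is nonempty and compact and lambda_max is
   continuous on it, so this supremum is a maximum. *)
Definition gamma (R : realType) (m : nat) (a : R) : R :=
  sup [set lambda_max B | B in calK m a]%classic.

(* U_r = {pi(1), ..., pi(r)}, with indices shifted to start at 0. *)
Definition prefix_set (m : nat) (pi : 'S_m) (r : nat) : {set 'I_m} :=
  [set pi k | k : 'I_m & (k < r)%N].

(* Main.v *)
Require Import Defs.
From mathcomp Require Import all_boot all_order all_algebra perm.
From mathcomp Require Import classical_sets reals.
From mathcomp Require Import ring lra.

(** A matrix B with largest eigenvalue gamma has a vector x at which its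
    quadratic form attains gamma |x|^2, while no matrix of the constraint set
    exceeds gamma |y|^2 at any y.  Perturbing B and x inside the constraint set
    shows that the tight sets, those U with energy |U|, are plentiful.

    The energy is supermodular in U, so tight sets are closed under union and
    intersection ([tightUI]).  If moreover they cover all indices and separate
    any two of them, a maximal chain of tight sets grows by one index at a time
    ([separating_lattice_chain]), which is the required permutation.

    Covering ([extremal_covered]): around an index in no tight set the entries
    of B are free, which contradicts extremality.  Since a tight set containing
    p loses tightness when its energy decreases, covering shows that energy
    cannot be saved for free in all tight sets containing p.  It follows that x
    has no zero coordinate ([extremal_coord_neq0]).

    Separation ([tight_separates]): suppose that no tight set separates p and q.
    If B_pq = 0, a small entry there raises the form to first order and costs
    energy to second order only ([inseparable_offdiag_neq0]).  If B_pq <> 0,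
    conjugate B by a rotation in the plane of p and q and rotate x
    accordingly.  The Frobenius norm of each block containing p and q is
    preserved, and the energy is half of its square minus (1/2 - 1/a) times
    the sum of the squared diagonal entries ([calI_frobenius]).  Because a > 2,
    a rotation spreading the diagonal entries at p and q saves energy for free
    in all tight sets containing p, against covering. *)

Import Order.TTheory GRing.Theory Num.Theory.
Local Open Scope ring_scope.
Set Implicit Arguments.
Unset Strict Implicit.
Unset Printing Implicit Defensive.

(** * Quadratic forms and the largest eigenvalue *)

Definition qform (R : realType) (m : nat) (B : 'M[R]_m) (x : 'rV[R]_m) : R :=
  (x *m B *m x^T) 0 0.

Definition sqnorm (R : realType) (m : nat) (x : 'rV[R]_m) : R :=
  (x *m x^T) 0 0.

Lemma qformE (R : realType) m (B : 'M[R]_m) x :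
  qform B x = \sum_i \sum_j x 0 i * B i j * x 0 j.
Proof.
rewrite /qform mxE exchange_big /=; apply: eq_bigr => j _.
by rewrite !mxE big_distrl.
Qed.

Lemma sqnormE (R : realType) m (x : 'rV[R]_m) : sqnorm x = \sum_i x 0 i ^+ 2.
Proof. by rewrite /sqnorm mxE; apply: eq_bigr => i _; rewrite mxE expr2. Qed.

Lemma sqnorm_ge0 (R : realType) m (x : 'rV[R]_m) : 0 <= sqnorm x.
Proof. by rewrite sqnormE; apply: sumr_ge0 => i _; apply: sqr_ge0. Qed.

Lemma coord_le_sqnorm (R : realType) m (x : 'rV[R]_m) i :
  x 0 i ^+ 2 <= sqnorm x.
Proof.
rewrite sqnormE (bigD1 i) //= lerDl.
by apply: sumr_ge0 => j _; apply: sqr_ge0.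
Qed.

Lemma sqnorm_eq0 (R : realType) m (x : 'rV[R]_m) : sqnorm x <= 0 -> x = 0.
Proof.
move=> x0; apply/rowP => i; rewrite mxE; apply/eqP; rewrite -sqrf_eq0 eq_le.
by rewrite sqr_ge0 (le_trans (coord_le_sqnorm x i) x0).
Qed.

Lemma sqnorm_gt0 (R : realType) m (x : 'rV[R]_m) : x != 0 -> 0 < sqnorm x.
Proof. by move=> x0; rewrite ltNge; apply: contra x0 => /sqnorm_eq0 ->. Qed.

Lemma qform_le_sum (R : realType) m (B : 'M[R]_m) x :
  qform B x <= (\sum_i \sum_j `|B i j|) * sqnorm x.
Proof.
rewrite qformE mulr_suml; apply: ler_sum => i _.
rewrite mulr_suml; apply: ler_sum => j _.
apply: le_trans (ler_norm _) _.
have hi := coord_le_sqnorm x i; have hj := coord_le_sqnorm x j.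
rewrite -[leLHS]mulr1 !normrM mulr1 -mulrA mulrCA ler_wpM2l //.
rewrite -(real_normK (num_real (x 0 i))) in hi.
rewrite -(real_normK (num_real (x 0 j))) in hj.
have := sqr_ge0 (`|x 0 i| - `|x 0 j|).
rewrite sqrrB; nra.
Qed.

Lemma qform_bounded (R : realType) m (B : 'M[R]_m) :
  exists2 C : R, 0 < C & forall x, qform B x <= C * sqnorm x.
Proof.
exists (1 + \sum_i \sum_j `|B i j|).
  by rewrite ltr_pwDl // sumr_ge0 // => i _; apply: sumr_ge0.
move=> x; apply: le_trans (qform_le_sum _ _) _.
by rewrite ler_wpM2r ?sqnorm_ge0 // lerDr.
Qed.

Lemma qform_scalar_sub (R : realType) m (c : R) (x : 'rV[R]_m) (B : 'M[R]_m) :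
  qform (c%:M - B) x = c * sqnorm x - qform B x.
Proof.
by rewrite /qform /sqnorm mulmxBr mulmxBl mul_mx_scalar -scalemxAl !mxE.
Qed.

(** A positive semidefinite form controls the image of its matrix: expand the
    form at y - t yA and choose t = 1/C, where C bounds the form.  This
    inequality replaces compactness below: it makes an invertible positive
    semidefinite form coercive, and forces isotropic vectors into the
    kernel. *)
Lemma psd_gap (R : realType) m (A : 'M[R]_m) :
  A = A^T -> (forall y, 0 <= qform A y) ->
  exists2 C : R, 0 < C & forall y, sqnorm (y *m A) <= C * qform A y.
Proof.
move=> symA posA; have [C C0 hC] := qform_bounded A; exists C => // y.
have := posA (y - C^-1 *: (y *m A)).
have -> : qform A (y - C^-1 *: (y *m A)) =
   qform A y - 2 * C^-1 * sqnorm (y *m A) + C^-1 ^+ 2 * qform A (y *m A).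
  rewrite /qform /sqnorm [(_ - _)^T]linearB /= [(_ *: _)^T]linearZ /=.
  rewrite trmx_mul -symA !(mulmxBl, mulmxBr) -!(scalemxAl, scalemxAr) !mulmxA.
  by rewrite !mxE; ring.
have := hC (y *m A) => h1 h2.
have h3 : C^-1 ^+ 2 * qform A (y *m A) <= C^-1 * sqnorm (y *m A).
  by rewrite expr2 -mulrA ler_wpM2l ?ler_pdivrMl // invr_ge0 ltW.
have h4 : C^-1 * sqnorm (y *m A) <= qform A y by lra.
by rewrite -ler_pdivrMl.
Qed.

(** The form of g - B is positive semidefinite and vanishes at x, hence x is in
    the kernel of g - B by [psd_gap]. *)
Lemma rayleigh_stationary (R : realType) m (B : 'M[R]_m) g x :
  B = B^T -> (forall y, qform B y <= g * sqnorm y) ->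
  qform B x = g * sqnorm x -> x *m B = g *: x.
Proof.
move=> symB hB hx.
have [] := @psd_gap _ _ (g%:M - B).
- by rewrite linearB /= tr_scalar_mx -symB.
- by move=> y; rewrite qform_scalar_sub subr_ge0.
move=> C C0 /(_ x); rewrite qform_scalar_sub hx subrr mulr0 => /sqnorm_eq0.
by rewrite mulmxBr mul_mx_scalar => /eqP; rewrite subr_eq0 => /eqP.
Qed.

(** The eigenvalue is the least s such that s - B is positive semidefinite.
    Were s - B invertible, [psd_gap] would make its form bounded below by a
    positive multiple of the square norm, and s could be decreased. *)
Lemma top_eigenvalue (R : realType) m (B : 'M[R]_m) :
  (0 < m)%N -> B = B^T ->
  exists2 s, eigenvalue B s & forall y, qform B y <= s * sqnorm y.
Proof.
move=> m0 symB.
pose S := [set c : R | forall y, qform B y <= c * sqnorm y]%classic.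
have [C0 _ hC0] := qform_bounded B.
pose e : 'rV[R]_m := const_mx 1.
have e0 : 0 < sqnorm e.
  apply: sqnorm_gt0; apply/eqP => /rowP /(_ (Ordinal m0)).
  by rewrite !mxE => /eqP; rewrite oner_eq0.
have infS : has_inf S.
  split; first by exists C0.
  exists (qform B e / sqnorm e) => c /(_ e).
  by rewrite ler_pdivrMr.
have Ss : S (inf S).
  move=> y; have [->|y0] := eqVneq y 0.
    by rewrite /qform /sqnorm !mul0mx mxE mulr0.
  rewrite -ler_pdivrMr ?sqnorm_gt0 //; apply: lb_le_inf; first by case: infS.
  by move=> c /(_ y); rewrite ler_pdivrMr ?sqnorm_gt0.
exists (inf S) => //; pose s := inf S; pose A := s%:M - B.
apply: contraT => neig; exfalso.
have uA : A \in unitmx.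
  move: neig; rewrite /eigenvalue /eigenspace negbK kermx_eq0 row_free_unit.
  by rewrite -(@unitmxZ _ _ (-1)) ?unitrN1 // scaleN1r opprB.
have symA : A = A^T by rewrite linearB /= tr_scalar_mx -symB.
have posA y : 0 <= qform A y by rewrite qform_scalar_sub subr_ge0; apply: Ss.
have [C1 C10 h1] := psd_gap symA posA.
have [C2 C20 h2] := qform_bounded (invmx A *m (invmx A)^T).
have : S (s - (C1 * C2)^-1).
  move=> y; have := h2 (y *m A); have := h1 y; rewrite qform_scalar_sub.
  have -> : qform (invmx A *m (invmx A)^T) (y *m A) = sqnorm y.
    rewrite /qform /sqnorm mulmxA mulmxK // -mulmxA -trmx_mul.
    by rewrite mulmxK.
  move=> k1 k2; rewrite mulrBl lerBrDr -lerBrDl ler_pdivrMl ?mulr_gt0 //.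
  by apply: le_trans k2 _; rewrite [C1 * C2]mulrC -mulrA ler_wpM2l // ltW.
move=> /(ge_inf (proj2 infS)); rewrite lerBrDr gerDl leNgt invr_gt0.
by rewrite mulr_gt0.
Qed.

Lemma lambda_maxP (R : realType) m (B : 'M[R]_m) :
  (0 < m)%N -> B = B^T ->
  eigenvalue B (lambda_max B) /\
  forall y, qform B y <= lambda_max B * sqnorm y.
Proof.
move=> m0 symB; have [s es hs] := top_eigenvalue m0 symB.
suff -> : lambda_max B = s by [].
have ub : ubound [set x : R | eigenvalue B x]%classic s.
  move=> x /= /eigenvalueP [v vB v0]; have := hs v.
  by rewrite /qform vB -scalemxAl mxE -/(sqnorm v) ler_pM2r ?sqnorm_gt0.
apply/eqP; rewrite eq_le; apply/andP; split.
  by apply: sup_le_ub => //; exists s.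
by apply: ub_le_sup => //; exists s.
Qed.

(** Besides the Rayleigh bound for a single matrix, this requires the set whose
    supremum is gamma to be bounded: a supremum of an unbounded set says
    nothing.  The constraint of the full index set bounds every entry. *)
Lemma qform_le_gamma (R : realType) m (a : R) (B : 'M[R]_m) :
  0 < a -> (0 < m)%N -> calK m a B ->
  forall y, qform B y <= gamma m a * sqnorm y.
Proof.
move=> a0 m0 KB y; have [symB _] := KB.
have [_ /(_ y) h] := lambda_maxP m0 symB; apply: le_trans h _.
rewrite ler_wpM2r ?sqnorm_ge0 //; apply: ub_le_sup; last by exists B.
(* D_ii^2 <= a m and D_ij^2 <= m; since M >= 1, also |D_ij| <= M. *)
pose M := 1 + a * m%:R + m%:R.
exists (m%:R * (m%:R * M)) => _ [D [symD KD] <-].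
have [/eigenvalueP [v vD v0] _] := lambda_maxP m0 symD.
have M0 : 0 <= a * m%:R by rewrite mulr_ge0 ?ler0n // ltW.
have ia0 : 0 <= 1 / a by rewrite divr_ge0 // ltW.
have m1 : 1 <= m%:R :> R by rewrite ler1n.
have T0 : [set: 'I_m] != finset.set0.
  by apply/set0Pn; exists (Ordinal m0); rewrite inE.
have := KD _ T0; rewrite cardsT card_ord /calI => hD.
have s1 : 0 <= 1 / a * \sum_(i in [set: 'I_m]) D i i ^+ 2.
  by rewrite mulr_ge0 // sumr_ge0 // => i _; apply: sqr_ge0.
have s2 (i : 'I_m) : 0 <= \sum_(j in [set: 'I_m] | (i < j)%N) D i j ^+ 2.
  by apply: sumr_ge0 => j _; apply: sqr_ge0.
have hlt (i j : 'I_m) : (i < j)%N -> D i j ^+ 2 <= m%:R.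
  move=> ij; apply: le_trans hD.
  apply: le_trans (_ : \sum_(j in [set: 'I_m] | (i < j)%N) D i j ^+ 2 <= _).
    rewrite (bigD1 j) ?inE ?ij //= lerDl.
    by apply: sumr_ge0 => k _; apply: sqr_ge0.
  apply: ler_wpDl => //; rewrite [leRHS](bigD1 i) ?inE //= lerDl.
  by apply: sumr_ge0.
have hD2 i j : D i j ^+ 2 <= M ^+ 2.
  have M1 : M <= M ^+ 2 by rewrite expr2 ler_peMl /M; lra.
  have [ij|ji|/val_inj ->] := ltngtP i j.
  - by have := hlt _ _ ij; rewrite /M in M1 *; lra.
  - by have := hlt _ _ ji; rewrite symD mxE -symD /M in M1 *; lra.
  suff : D j j ^+ 2 <= a * m%:R by rewrite /M in M1 *; lra.
  rewrite -ler_pdivrMl // -[a^-1]mul1r; apply: le_trans hD.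
  apply: (@le_trans _ _ (1 / a * \sum_(i in [set: 'I_m]) D i i ^+ 2)).
    rewrite ler_wpM2l // (bigD1 j) ?inE //= lerDl.
    by apply: sumr_ge0 => k _; apply: sqr_ge0.
  by rewrite lerDl; apply: sumr_ge0.
have := qform_le_sum D v; rewrite /qform vD -scalemxAl mxE -/(sqnorm v).
rewrite ler_pM2r ?sqnorm_gt0 // => hle; apply: le_trans hle _.
have hc (c : R) : c *+ m = \sum_(i < m) c by rewrite sumr_const card_ord.
rewrite [leRHS]mulr_natl hc; apply: ler_sum => i _.
rewrite [leRHS]mulr_natl hc; apply: ler_sum => j _.
have Mge0 : 0 <= M by rewrite /M; lra.
rewrite -(@ler_pXn2r _ 2) ?nnegrE ?normr_ge0 //.
by rewrite real_normK ?num_real.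
Qed.

(** * The energy as a weighted sum over ordered pairs *)

(** Each unordered pair of distinct indices occurs twice among the ordered
    pairs, whence the factor one half off the diagonal. *)
Definition weight (R : realType) (a : R) m (i j : 'I_m) : R :=
  if i == j then a^-1 else 2^-1.

Lemma weight_gt0 (R : realType) (a : R) m (i j : 'I_m) :
  0 < a -> 0 < weight a i j.
Proof. by rewrite /weight; case: eqP; rewrite invr_gt0 ?ltr0n. Qed.

Lemma calIE (R : realType) (a : R) m (U : {set 'I_m}) (B : 'M[R]_m) :
  B = B^T ->
  calI a U B =
  \sum_i \sum_j ((i \in U) && (j \in U))%:R * (weight a i j * B i j ^+ 2).
Proof.
move=> symB.
pose F i j := ((i \in U) && (j \in U))%:R * (weight a i j * B i j ^+ 2).
pose H := \sum_(i < m) \sum_(j < m | (i < j)%N) F i j.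
have symF i j : F i j = F j i.
  by rewrite /F andbC /weight eq_sym [in B i j]symB mxE.
have HE : H = \sum_(i < m) \sum_(j < m | (j < i)%N) F i j.
  rewrite /H (exchange_big_dep xpredT) //=; apply: eq_bigr => i _.
  by apply: eq_bigr => j _; apply: symF.
have -> : \sum_i \sum_j F i j = (\sum_i F i i) + (H + H).
  rewrite {2}HE -!big_split /=; apply: eq_bigr => i _.
  rewrite (bigD1 i) //= [X in _ + X](bigID (fun j : 'I_m => (i < j)%N)) /=.
  congr (_ + (_ + _)); apply: eq_bigl => j.
    by rewrite -(inj_eq val_inj) /= ; case: ltngtP.
  by rewrite -(inj_eq val_inj) /= ; case: ltngtP.
rewrite /calI; congr (_ + _).
  rewrite mul1r mulr_sumr big_mkcond /=; apply: eq_bigr => i _.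
  by rewrite /F /weight eqxx andbb; case: (i \in U); rewrite ?mul1r ?mul0r.
rewrite -mulr2n -mulr_natl /H mulr_sumr big_mkcond; apply: eq_bigr => i _.
case: ifP => iU; last first.
  by rewrite big1 ?mulr0 // => j _; rewrite /F iU mul0r.
rewrite mulr_sumr big_mkcondl /=; apply: eq_bigr => j ij.
rewrite /F iU /= /weight -(inj_eq val_inj) /= ltn_eqF //.
case: (j \in U); last by rewrite mul0r mulr0.
by rewrite mul1r mulrA divff ?mul1r ?pnatr_eq0.
Qed.

(** * Changing one entry of a symmetric matrix *)

Definition sym_update (R : realType) m (B : 'M[R]_m) (p q : 'I_m) (v : R)
  : 'M[R]_m :=
  \matrix_(i, j)
    if (i == p) && (j == q) || (i == q) && (j == p) then v else B i j.

Lemma sym_update_sym (R : realType) m (B : 'M[R]_m) p q v :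
  B = B^T -> sym_update B p q v = (sym_update B p q v)^T.
Proof.
move=> symB; apply/matrixP => i j; rewrite !mxE orbC andbC [X in _ || X]andbC.
by rewrite {1}symB mxE.
Qed.

Lemma sum_two_entries (R : realType) m (F G : 'I_m -> 'I_m -> R) (p q : 'I_m) :
  (forall i j, F i j = F j i) -> (forall i j, G i j = G j i) ->
  (forall i j, ~~ ((i == p) && (j == q) || (i == q) && (j == p)) ->
     F i j = G i j) ->
  \sum_i \sum_j F i j =
  \sum_i \sum_j G i j + (if p == q then 1 else 2) * (F p q - G p q).
Proof.
move=> symF symG FG; apply/eqP; rewrite addrC -subr_eq -sumrB; apply/eqP.
under eq_bigr do rewrite -sumrB.
rewrite pair_big /= (bigD1 (p, q)) //=.
have [pq|npq] := eqVneq p q.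
  rewrite big1 ?addr0 ?mul1r // => -[i j] /= ne.
  rewrite xpair_eqE -pq in ne.
  by rewrite FG ?subrr // -pq orbb.
rewrite (bigD1 (q, p)) /=; last by rewrite xpair_eqE negb_and eq_sym npq.
rewrite big1 ?addr0; last first.
  move=> [i j] /=; rewrite !xpair_eqE -negb_or => ne.
  by rewrite FG ?subrr.
by rewrite [F q p]symF [G q p]symG -mulr2n mulr_natl.
Qed.

Lemma calI_sym_update (R : realType) (a : R) m (U : {set 'I_m}) (B : 'M[R]_m)
    p q v :
  B = B^T ->
  calI a U (sym_update B p q v) = calI a U B +
  ((p \in U) && (q \in U))%:R *
    ((if p == q then a^-1 else 1) * (v ^+ 2 - B p q ^+ 2)).
Proof.
move=> symB; rewrite (calIE _ _ (sym_update_sym p q v symB)) (calIE _ _ symB).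
rewrite (@sum_two_entries _ _ _
  (fun i j => ((i \in U) && (j \in U))%:R * (weight a i j * B i j ^+ 2)) p q).
- congr (_ + _); rewrite mxE !eqxx /= /weight.
  case: (_ && _); last by rewrite !mul0r subrr mulr0.
  case: eqP => _; first by ring.
  by field.
- move=> i j; rewrite andbC /weight eq_sym; congr (_ * (_ * _ ^+ 2)).
  by rewrite [in LHS](sym_update_sym _ _ _ symB) mxE.
- by move=> i j; rewrite andbC /weight eq_sym {1}symB mxE.
- by move=> i j ne; rewrite mxE (negPf ne).
Qed.

Lemma qform_sym_update (R : realType) m (B : 'M[R]_m) p q v x :
  B = B^T ->
  qform (sym_update B p q v) x = qform B x +
  (if p == q then 1 else 2) * (v - B p q) * (x 0 p * x 0 q).
Proof.
move=> symB; rewrite !qformE.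
rewrite (@sum_two_entries _ _ _ (fun i j => x 0 i * B i j * x 0 j) p q).
- by rewrite mxE !eqxx /=; congr (_ + _); ring.
- move=> i j; rewrite [in LHS](sym_update_sym _ _ _ symB) mxE; ring.
- by move=> i j; rewrite {1}symB mxE; ring.
- by move=> i j ne; rewrite mxE (negPf ne).
Qed.

(** * Strict constraints persist under small perturbations *)

Lemma calI_close (R : realType) (a : R) m (B : 'M[R]_m) (s : R) :
  0 < a -> B = B^T -> 0 < s ->
  exists2 d : R, 0 < d & forall (D : 'M[R]_m), D = D^T ->
    (forall i j, `|D i j - B i j| <= d) ->
    forall U, calI a U D < calI a U B + s.
Proof.
move=> a0 symB s0.
pose L := \sum_i \sum_j weight a i j * (2 * `|B i j| + 1).
have L0 : 0 <= L.
  apply: sumr_ge0 => i _; apply: sumr_ge0 => j _.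
  rewrite mulr_ge0 ?addr_ge0 ?mulr_ge0 //.
  exact: ltW (weight_gt0 _ _ a0).
have L1 : 0 < L + 1 by lra.
exists (Num.min 1 (s / (L + 1))).
  by rewrite lt_min ltr01 divr_gt0.
set d := Num.min _ _.
have d0 : 0 < d by rewrite /d lt_min ltr01 divr_gt0.
have d1 : d <= 1 by rewrite ge_min lexx.
have dL : d * L < s.
  apply: (@lt_le_trans _ _ (d * (L + 1))); first by rewrite ltr_pM2l //; lra.
  by rewrite -ler_pdivlMr // ge_min lexx orbT.
move=> D symD hD U.
suff : calI a U D <= calI a U B + d * L.
  by move=> /le_lt_trans; apply; rewrite ltrD2l.
rewrite (calIE _ _ symB) (calIE _ _ symD) /L mulr_sumr -big_split /=.
apply: ler_sum => i _; rewrite mulr_sumr -big_split /=; apply: ler_sum => j _.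
have w0 := weight_gt0 i j a0.
have hB : D i j ^+ 2 <= B i j ^+ 2 + d * (2 * `|B i j| + 1).
  have := hD i j; rewrite ler_norml => /andP [h1 h2].
  have : B i j <= `|B i j| by apply: ler_norm.
  have : - B i j <= `|B i j| by rewrite -normrN ler_norm.
  nra.
have e0 : 0 <= d * (2 * `|B i j| + 1).
  by rewrite mulr_ge0 ?addr_ge0 ?mulr_ge0 // ltW.
case: (_ && _); rewrite ?mul1r ?mul0r ?add0r; last first.
  by rewrite mulrCA mulr_ge0 // ltW.
by rewrite [d * _]mulrCA -mulrDr ler_wpM2l // ltW.
Qed.

(** There are finitely many constraints, so the strict ones have a common
    positive slack.  A perturbation of B thus has to be checked only on the
    tight sets. *)
Lemma slack_open (R : realType) (a : R) m (B : 'M[R]_m) :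
  0 < a -> B = B^T ->
  exists2 d : R, 0 < d & forall D : 'M[R]_m, D = D^T ->
    (forall i j, `|D i j - B i j| <= d) ->
    forall U, calI a U B < #|U|%:R -> calI a U D < #|U|%:R.
Proof.
move=> a0 symB.
pose s := \big[Num.min/1]_(U : {set 'I_m} | calI a U B < #|U|%:R)
            (#|U|%:R - calI a U B).
have s0 : 0 < s.
  rewrite /s; elim/big_rec: _ => // U y hU y0.
  by rewrite lt_min y0 subr_gt0 hU.
have [d d0 hd] := calI_close a0 symB s0; exists d => // D symD close U hU.
apply: lt_le_trans (hd _ symD close U) _.
by rewrite -lerBrDl; apply: bigmin_le_cond.
Qed.

(** * Tight sets of an extremal matrix *)

Definition tight (R : realType) (a : R) m (B : 'M[R]_m) (U : {set 'I_m}) :=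
  calI a U B == #|U|%:R.

(** The vector x is kept along with B because the arguments below replace the
    pair (B, x) by another one with the same Rayleigh quotient g. *)
Definition extremal (R : realType) (a g : R) m (B : 'M[R]_m) (x : 'rV[R]_m) :=
  [/\ calK m a B, x != 0, qform B x = g * sqnorm x &
      forall D, calK m a D -> forall y, qform D y <= g * sqnorm y].

Lemma calI_le (R : realType) (a : R) m (B : 'M[R]_m) (U : {set 'I_m}) :
  calK m a B -> calI a U B <= #|U|%:R.
Proof.
move=> [_ KB]; have [->|/KB //] := eqVneq U finset.set0.
rewrite /calI cards0 !big1 ?mulr0 ?addr0 // => i; by rewrite inE.
Qed.

Lemma not_tight (R : realType) (a : R) m (B : 'M[R]_m) (U : {set 'I_m}) :
  calK m a B -> ~~ tight a B U -> calI a U B < #|U|%:R.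
Proof. by move=> KB nt; rewrite lt_neqAle nt calI_le. Qed.

Lemma tight0 (R : realType) (a : R) m (B : 'M[R]_m) : tight a B finset.set0.
Proof.
rewrite /tight /calI cards0 !big1 ?mulr0 ?addr0 // => i; by rewrite inE.
Qed.

(** If no tight set contains p, every entry in row p can be perturbed freely.
    Increasing B_pp raises the form at x unless x_p = 0.  If x_p = 0, pick q
    with x_q <> 0: changing B_pq keeps the value of the form at x, so x is an
    eigenvector both before and after the change, yet the p-th coordinate of
    the image of x changes by a nonzero multiple of x_q. *)
Lemma extremal_covered (R : realType) (a g : R) m (B : 'M[R]_m) x p :
  0 < a -> extremal a g B x -> exists2 U, tight a B U & p \in U.
Proof.
move=> a0 [KB x0 Bx top]; have [symB _] := KB.
case: (boolP [exists U, tight a B U && (p \in U)]).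
  by move=> /existsP [U /andP [tU pU]]; exists U.
rewrite negb_exists => /forallP unc; exfalso.
have [d d0 hd] := slack_open a0 symB.
have Kupd q : calK m a (sym_update B p q (B p q + d)).
  split; first exact: sym_update_sym.
  move=> U _; case: (boolP (p \in U)) => pU; last first.
    by rewrite calI_sym_update // (negPf pU) mul0r addr0 calI_le.
  apply/ltW/hd; [exact: sym_update_sym| |apply: not_tight => //].
    move=> i j; rewrite mxE.
    case: ifP => [|_]; last by rewrite subrr normr0 ltW.
    move=> /orP [] /andP [/eqP -> /eqP ->]; last rewrite [in B q p]symB mxE.
      by rewrite addrC addKr gtr0_norm.
    by rewrite addrC addKr gtr0_norm.
  by have := unc U; rewrite pU andbT.
have xp0 : x 0 p = 0.
  have := top _ (Kupd p) x; rewrite qform_sym_update // eqxx Bx gerDl mul1r.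
  rewrite addrC addKr pmulr_rle0 // -expr2 => h.
  by apply/eqP; rewrite -sqrf_eq0 eq_le h sqr_ge0.
have [q xq0] : exists q, x 0 q != 0.
  apply/existsP; rewrite -negb_forall; apply: contra x0 => /forallP h.
  by apply/eqP/rowP => i; rewrite mxE; apply/eqP.
have pq : p != q by apply: contraNneq xq0 => <-; rewrite xp0.
pose D := sym_update B p q (B p q + d).
have Dx : qform D x = g * sqnorm x.
  by rewrite qform_sym_update // Bx xp0 mul0r mulr0 addr0.
have := rayleigh_stationary (sym_update_sym p q _ symB) (top _ (Kupd q)) Dx.
have := rayleigh_stationary symB (top _ KB) Bx.
move=> /rowP /(_ p); rewrite !mxE xp0 mulr0 => e1.
move=> /rowP /(_ p); rewrite !mxE xp0 mulr0 => e2.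
move: e2; under eq_bigr => j _.
  rewrite mxE [j == p]eq_sym eqxx andbT orbC.
  have -> : x 0 j * (if (j == q) || (p == j) && (p == q)
      then B p q + d else B j p) = x 0 j * B j p + (j == q)%:R * (x 0 q * d).
    rewrite (negPf pq) andbF orbF; case: eqP => [->|_].
      by rewrite [in B p q]symB mxE mul1r mulrDr.
    by rewrite mul0r addr0.
  over.
rewrite big_split /= e1 add0r (bigD1 q) //= eqxx mul1r big1 ?addr0; last first.
  by move=> j /negPf ->; rewrite mul0r.
by move/eqP; rewrite mulf_eq0 (negPf xq0) (gt_eqF d0).
Qed.

(** An ordered pair that lies in U or in V lies in the union, and one that lies
    in both lies in the intersection; the weights are nonnegative. *)
Lemma calI_supermodular (R : realType) (a : R) m (B : 'M[R]_m)
    (U V : {set 'I_m}) :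
  0 < a -> B = B^T ->
  calI a U B + calI a V B <= calI a (U :|: V) B + calI a (U :&: V) B.
Proof.
move=> a0 symB; rewrite !(calIE _ _ symB) -!big_split /=.
apply: ler_sum => i _; rewrite -!big_split /=; apply: ler_sum => j _.
have w0 : 0 <= weight a i j * B i j ^+ 2.
  by rewrite mulr_ge0 ?sqr_ge0 // ltW ?weight_gt0.
rewrite -!mulrDl ler_wpM2r // -!natrD ler_nat !inE.
by case: (i \in U); case: (i \in V); case: (j \in U); case: (j \in V).
Qed.

(** Energy is supermodular and cardinality is modular, so equality in the
    constraints of U and V forces equality for union and intersection. *)
Lemma tightUI (R : realType) (a : R) m (B : 'M[R]_m) (U V : {set 'I_m}) :
  0 < a -> calK m a B -> tight a B U -> tight a B V ->
  tight a B (U :|: V) /\ tight a B (U :&: V).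
Proof.
move=> a0 KB /eqP tU /eqP tV; have [symB _] := KB.
have := calI_supermodular U V a0 symB; rewrite tU tV.
have := calI_le (U :|: V) KB; have := calI_le (U :&: V) KB.
have /(congr1 (fun n => n%:R : R)) := cardsUI U V; rewrite !natrD => e h1 h2 h3.
by split; apply/eqP; lra.
Qed.

Lemma calI_setD1 (R : realType) (a : R) m (B : 'M[R]_m) (U : {set 'I_m}) p :
  B = B^T -> (forall j, j \in U -> B p j = 0) ->
  calI a (U :\ p) B = calI a U B.
Proof.
move=> symB h0; rewrite !(calIE _ _ symB); apply: eq_bigr => i _.
apply: eq_bigr => j _; rewrite !inE.
case iU: (i \in U); case jU: (j \in U); rewrite ?andbF ?andbT //=.
have [->|_] := eqVneq i p; first by rewrite h0 // expr0n /= !mulr0.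
have [->|_] //= := eqVneq j p; first by rewrite symB mxE h0 // expr0n /= !mulr0.
Qed.

(** Let W be a smallest tight set containing p; by [tightUI] it is included in
    all the others.  If row p vanished on W, then W minus p would have energy
    |W|, which exceeds its cardinality.  Shrinking the entry at (p, j) creates
    slack in all the tight sets containing p at once. *)
Lemma essential_entry (R : realType) (a g : R) m (B : 'M[R]_m) x p :
  0 < a -> extremal a g B x ->
  exists2 j, B p j != 0 & forall U, tight a B U -> p \in U -> j \in U.
Proof.
move=> a0 ext; have [KB _ _ _] := ext; have [symB _] := KB.
have [U0 tU0 pU0] := extremal_covered p a0 ext.
pose P (U : {set 'I_m}) := tight a B U && (p \in U).
have P0 : P U0 by rewrite /P tU0.
case: (arg_minnP (fun U : {set 'I_m} => #|U|) P0) => W /andP [tW pW] minW.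
have [j /andP [jW Bj]] : exists j, (j \in W) && (B p j != 0).
  apply/existsP; apply: contraT; rewrite negb_exists => /forallP h.
  have h0 j : j \in W -> B p j = 0.
    by move=> jW; have := h j; rewrite jW /= negbK => /eqP.
  have := calI_le (W :\ p) KB; rewrite (calI_setD1 _ symB h0) (eqP tW) ler_nat.
  by rewrite (cardsD1 p W) pW ltnn.
exists j => // U tU pU.
have [_ tWU] := tightUI a0 KB tW tU.
have sWU : W :&: U = W.
  by apply/eqP; rewrite eqEcard subsetIl minW // /P tWU inE pW pU.
by move: jW; rewrite -sWU inE => /andP [].
Qed.

(** If x_p = 0, the entries in row p do not contribute to the form at x.
    Cancelling an essential one gives another extremal matrix in which no
    tight set contains p. *)
Lemma extremal_coord_neq0 (R : realType) (a g : R) m (B : 'M[R]_m) x p :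
  0 < a -> extremal a g B x -> x 0 p != 0.
Proof.
move=> a0 ext; have [KB x0 Bx top] := ext; have [symB _] := KB.
have [j Bj jU] := essential_entry p a0 ext.
apply/eqP => xp0; pose D := sym_update B p j 0.
have drop U : calI a U D <= calI a U B /\
    (p \in U -> j \in U -> calI a U D < calI a U B).
  rewrite /D calI_sym_update // expr0n /= sub0r.
  have h : (if p == j then a^-1 else 1) * - B p j ^+ 2 < 0.
    rewrite mulrN oppr_lt0 mulr_gt0 //; first by case: ifP; rewrite ?invr_gt0.
    by rewrite exprn_even_gt0.
  split; last by move=> -> ->; rewrite mul1r gtrDl.
  by rewrite gerDl; case: (_ && _); rewrite ?mul1r ?mul0r // ltW.
have KD : calK m a D.
  split; first exact: sym_update_sym.
  by move=> U _; apply: le_trans (calI_le U KB); case: (drop U).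
have [] := @extremal_covered _ a g _ D x p a0.
  split=> //; first by rewrite /D qform_sym_update // Bx xp0 mul0r mulr0 addr0.
move=> U tU pU; have [tBU|nt] := boolP (tight a B U).
  have [_ /(_ pU (jU _ tBU pU))] := drop U.
  by rewrite (eqP tU) (eqP tBU) ltxx.
have [h _] := drop U; have := le_lt_trans h (not_tight KB nt).
by rewrite (eqP tU) ltxx.
Qed.

(** * Indices that no tight set separates *)

Lemma abs_entry_le_sum (R : realType) m (B : 'M[R]_m) i j :
  `|B i j| <= \sum_k \sum_l `|B k l|.
Proof.
rewrite (bigD1 i) //= (bigD1 j) //= -addrA lerDl addr_ge0 //.
  by apply: sumr_ge0.
by apply: sumr_ge0 => k _; apply: sumr_ge0.
Qed.

(** If B_pq = 0, making this entry of order t costs energy of order t^2 only,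
    in the tight sets containing p and q.  All of them contain the essential
    entry (p, j), and shrinking it by a factor 1 - O(t^2) pays this cost.  The
    form at x gains 2 t (x_p x_q)^2 and loses O(t^2), so it increases for
    small t. *)
Lemma inseparable_offdiag_neq0 (R : realType) (a g : R) m (B : 'M[R]_m) x p q :
  0 < a -> extremal a g B x -> p != q ->
  (forall U, tight a B U -> (p \in U) = (q \in U)) -> B p q != 0.
Proof.
move=> a0 ext pq insep; apply/eqP => Bpq.
have [KB x0 Bx top] := ext; have [symB _] := KB.
have [j Bj jU] := essential_entry p a0 ext.
have [d d0 hd] := slack_open a0 symB.
have jq : j != q by apply: contraNneq Bj => ->; rewrite Bpq.
pose y := x 0 p * x 0 q.
have y0 : y != 0 by rewrite mulf_neq0 // (extremal_coord_neq0 _ a0 ext).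
have y2 : 0 < y ^+ 2 by rewrite exprn_even_gt0.
pose b := B p j.
have b2 : 0 < b ^+ 2 by rewrite exprn_even_gt0.
pose w : R := if p == j then a^-1 else 1.
have w0 : 0 < w by rewrite /w; case: ifP => _; rewrite ?invr_gt0.
(* the energy decreases at (p, j) by at least w b^2 (t^2 k) and increases at
   (p, q) by t^2 y^2: k balances the two *)
pose k := y ^+ 2 / (w * b ^+ 2).
have k0 : 0 < k by rewrite divr_gt0 // mulr_gt0.
have kE : w * b ^+ 2 * k = y ^+ 2 by rewrite mulrC divfK // gt_eqF // mulr_gt0.
(* t^2 e is the loss in the form at x *)
pose e := (if p == j then 1 else 2) * (k * b) * (x 0 p * x 0 j).
(* L dominates every coefficient that t has to make small *)
pose L := 1 + k + `|e| + `|y| + k * `|b|.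
have kb0 : 0 <= k * `|b| by rewrite mulr_ge0 // ltW.
have [e0 ny0] : 0 <= `|e| /\ 0 <= `|y| by [].
have L0 : 0 < L by rewrite /L; lra.
pose t := Num.min (Num.min 1 d) (y ^+ 2) / L.
have mu0 : 0 < Num.min (Num.min 1 d) (y ^+ 2) by rewrite !lt_min ltr01 d0.
have t0 : 0 < t by rewrite divr_gt0.
have tL : t * L = Num.min (Num.min 1 d) (y ^+ 2) by rewrite divfK // gt_eqF.
have [tL1 tLd tLy] : [/\ t * L <= 1, t * L <= d & t * L <= y ^+ 2].
  by rewrite tL; split; rewrite !ge_min lexx ?orbT.
have small r : 0 <= r -> r <= L -> t * r <= t * L.
  by move=> *; rewrite ler_pM2l.
have tt : t <= 1.
  rewrite -[t]mulr1; apply: le_trans tL1; apply: small => //.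
  by rewrite /L; lra.
pose h := t ^+ 2 * k.
have h0 : 0 < h by rewrite mulr_gt0 // exprn_gt0.
have htk : h <= t * k by rewrite /h expr2 -mulrA ler_piMl // mulr_ge0 // ltW.
have h1 : h <= 1.
  apply: le_trans htk _; apply: le_trans tL1; apply: small; first exact: ltW.
  by rewrite /L; lra.
pose D1 := sym_update B p q (t * y); pose D := sym_update D1 p j ((1 - h) * b).
have symD1 : D1 = D1^T by apply: sym_update_sym.
have symD : D = D^T by apply: sym_update_sym.
have D1pj : D1 p j = b.
  by rewrite mxE eqxx (negPf jq) (negPf pq).
have ID U : calI a U D = calI a U B + ((p \in U) && (q \in U))%:R * (t * y) ^+ 2
   + ((p \in U) && (j \in U))%:R * (w * (((1 - h) * b) ^+ 2 - b ^+ 2)).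
  rewrite /D calI_sym_update // D1pj /D1 calI_sym_update //.
  by rewrite Bpq (negPf pq) expr0n subr0 mul1r.
have closeD i l : `|D i l - B i l| <= d.
  have hy : `|t * y| <= d.
    rewrite normrM (gtr0_norm t0); apply: le_trans tLd.
    by apply: small => //; rewrite /L; lra.
  have hb : `|(1 - h) * b - b| <= d.
    rewrite mulrBl mul1r addrAC subrr sub0r normrN normrM (gtr0_norm h0).
    apply: le_trans tLd; apply: (@le_trans _ _ (t * (k * `|b|))).
      by rewrite mulrA ler_wpM2r.
    by apply: small => //; rewrite /L; lra.
  rewrite mxE; case: ifP => [/orP [] /andP [/eqP -> /eqP ->] //|_].
    by rewrite [in B j p]symB mxE.
  rewrite mxE; case: ifP => [/orP [] /andP [/eqP -> /eqP ->] //|_].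
  - by rewrite Bpq subr0.
  - by rewrite [in B q p]symB mxE Bpq subr0.
  by rewrite subrr normr0 ltW.
have KD : calK m a D.
  split=> // U _; have [tU|nt] := boolP (tight a B U); last first.
    by apply/ltW/hd => //; apply: not_tight.
  rewrite ID (eqP tU) -addrA gerDl -(insep _ tU).
  have [pU|_] := boolP (p \in U); last by rewrite !mul0r addr0.
  rewrite (jU _ tU pU) !mul1r.
  have -> : w * (((1 - h) * b) ^+ 2 - b ^+ 2) =
      - ((w * b ^+ 2 * k) * t ^+ 2) * (2 - h).
    by rewrite /h; ring.
  rewrite kE exprMn mulNr subr_le0 mulrC.
  have ty : 0 <= y ^+ 2 * t ^+ 2 by rewrite -exprMn sqr_ge0.
  by rewrite ler_peMr //; lra.
have := top _ KD x; rewrite qform_sym_update // D1pj /D1 qform_sym_update //.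
rewrite Bx Bpq (negPf pq).
have -> : (if p == j then 1 else 2) * ((1 - h) * b - b) * (x 0 p * x 0 j) =
    - (t ^+ 2 * e).
  by rewrite /e /h; case: (p == j); ring.
rewrite -/y subr0 -addrA gerDl.
have te : t * `|e| <= y ^+ 2.
  by apply: le_trans tLy; apply: small => //; rewrite /L; lra.
have : t * e <= t * `|e| by rewrite ler_pM2l // ler_norm.
have -> : 2 * (t * y) * y - t ^+ 2 * e = t * (2 * y ^+ 2 - t * e) by ring.
rewrite pmulr_rle0 //; lra.
Qed.

(** * Rotations in a coordinate plane *)

Definition plane_rot (R : realType) m (p q : 'I_m) (c s : R) : 'M[R]_m :=
  \matrix_(k, j)
    if j == p then c * (k == p)%:R + s * (k == q)%:R
    else if j == q then c * (k == q)%:R - s * (k == p)%:R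
    else (k == j)%:R.

Lemma mul_rot (R : realType) m n (A : 'M[R]_(n, m)) (p q : 'I_m) (c s : R) i j :
  (A *m plane_rot p q c s) i j =
    if j == p then c * A i p + s * A i q
    else if j == q then c * A i q - s * A i p
    else A i j.
Proof.
have pick l : A i l = \sum_k A i k * (k == l)%:R.
  rewrite (bigD1 l) //= eqxx mulr1 big1 ?addr0 // => k /negPf ->.
  by rewrite mulr0.
rewrite mxE; under eq_bigr do rewrite mxE.
case: ifP => [_|_]; last case: ifP => _; last by rewrite [RHS]pick.
  rewrite (pick p) (pick q) !mulr_sumr -big_split /=.
  by apply: eq_bigr => k _; ring.
rewrite (pick p) (pick q) !mulr_sumr -sumrN -big_split /=.
by apply: eq_bigr => k _; ring.
Qed.

Lemma rot_orthogonal (R : realType) m (p q : 'I_m) (c s : R) :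
  p != q -> c ^+ 2 + s ^+ 2 = 1 ->
  (plane_rot p q c s)^T *m plane_rot p q c s = 1%:M.
Proof.
move=> pq cs; apply/matrixP => i j; rewrite mul_rot !mxE.
have qp : (q == p) = false by rewrite eq_sym (negPf pq).
rewrite !eqxx (negPf pq) qp.
have [jp|jp] := eqVneq j p; last have [jq|jq] := eqVneq j q.
- rewrite jp; have [ip|ip] := boolP (i == p).
    by transitivity (c ^+ 2 + s ^+ 2); [rewrite /=; ring|rewrite cs].
  rewrite [p == i]eq_sym [q == i]eq_sym (negPf ip).
  by case: (i == q) => /=; ring.
- rewrite jq; have [/eqP ->|ip] := boolP (i == p).
    by rewrite (negPf pq) /=; ring.
  have [iq|iq] := boolP (i == q).
    by transitivity (c ^+ 2 + s ^+ 2); [rewrite /=; ring|rewrite cs].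
  by rewrite [q == i]eq_sym [p == i]eq_sym (negPf ip) (negPf iq) /=; ring.
rewrite [j == i]eq_sym.
have [/eqP ->|ip] := boolP (i == p).
  by rewrite [p == j]eq_sym (negPf jp) /=; ring.
have [/eqP ->|iq //] := boolP (i == q).
by rewrite [q == j]eq_sym (negPf jq) /=; ring.
Qed.

(** The energy of U is half of the squared Frobenius norm of the block of B
    on U, corrected by a multiple of the squared diagonal.  For a > 2 the
    coefficient of the correction is negative. *)
Lemma calI_frobenius (R : realType) (a : R) m (B : 'M[R]_m) (U : {set 'I_m}) :
  B = B^T ->
  let P := diag_mx (\row_i (i \in U)%:R) in
  calI a U B = 2^-1 * \tr (P *m B *m P *m B)
    + (a^-1 - 2^-1) * \sum_(i in U) B i i ^+ 2.
Proof.
move=> symB P; rewrite (calIE _ _ symB) /mxtrace.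
have PB i j : (P *m B) i j = (i \in U)%:R * B i j.
  by rewrite mul_diag_mx !mxE.
rewrite [X in _ + _ * X]big_mkcond !mulr_sumr -big_split; apply: eq_bigr => i _.
rewrite -mulmxA mxE /=.
under [X in _ = _ * X + _]eq_bigr => j _ do
  rewrite !PB [in B j i]symB [B^T _ _]mxE.
rewrite (bigD1 i) //= [X in _ = _ * X + _](bigD1 i) //= mulrDr addrAC.
congr (_ + _).
  rewrite /weight eqxx; case: (i \in U) => /=; ring.
rewrite mulr_sumr; apply: eq_bigr => j ji.
rewrite /weight eq_sym (negPf ji).
by case: (i \in U); case: (j \in U) => /=; ring.
Qed.

(** A set containing both or neither of p and q has a coordinate projection that
    commutes with the rotation, so the trace is invariant by conjugation. *)
Lemma frobenius_rot (R : realType) m (B : 'M[R]_m) (U : {set 'I_m}) p q c s :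
  p != q -> c ^+ 2 + s ^+ 2 = 1 -> (p \in U) = (q \in U) ->
  let P := diag_mx (\row_i (i \in U)%:R) in
  let Q := plane_rot p q c s in
  let D := Q^T *m B *m Q in
  \tr (P *m D *m P *m D) = \tr (P *m B *m P *m B).
Proof.
move=> pq cs pqU P Q D.
have QQ : Q *m Q^T = 1%:M by apply: mulmx1C; apply: rot_orthogonal.
have PQ : P *m Q = Q *m P.
  apply/matrixP => i j; rewrite mul_diag_mx mul_mx_diag !mxE.
  have [->|jp] := eqVneq j p; last have [->|jq] := eqVneq j q.
  - have [->|ip] := eqVneq i p; first by rewrite (negPf pq) mulrC.
    by have [->|iq] := eqVneq i q; rewrite /= ?pqU; ring.
  - have [->|ip] := eqVneq i p; first by rewrite (negPf pq) /= pqU; ring.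
    by have [->|iq] := eqVneq i q; rewrite /=; ring.
  by have [->|ij] := eqVneq i j; rewrite /=; ring.
have PT : P^T = P by apply: tr_diag_mx.
have PQT : P *m Q^T = Q^T *m P.
  by rewrite -[LHS]trmxK trmx_mul trmxK PT -PQ trmx_mul PT.
rewrite /D !mulmxA PQT mxtrace_mulC !mulmxA.
rewrite QQ mul1mx -[_ *m Q *m P]mulmxA -PQ mulmxA -[_ *m Q *m Q^T]mulmxA QQ.
by rewrite mulmx1.
Qed.

(** The rotation preserves the sum of the two diagonal entries and changes
    their difference F = A - E into (c^2 - s^2) F + 4 c s b.  When s has the
    sign of F b, the cross term of its square absorbs the loss s^2 F^2 for
    small s, and the term in s^2 b^2 makes the increase strict. *)
Lemma spread_diagonal (R : realType) (A E b c s : R) :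
  b != 0 -> s != 0 -> 0 < c -> c ^+ 2 + s ^+ 2 = 1 -> `|s| <= 2^-1 ->
  `|s| * `|A - E| <= `|b| -> 0 <= s * ((A - E) * b) ->
  A ^+ 2 + E ^+ 2 < (c ^+ 2 * A + 2 * c * s * b + s ^+ 2 * E) ^+ 2 +
                    (s ^+ 2 * A - 2 * c * s * b + c ^+ 2 * E) ^+ 2.
Proof.
move=> b0 s0 c0 cs sh sb sg.
have s2 : 0 < s ^+ 2 by rewrite exprn_even_gt0.
have b2 : 0 < b ^+ 2 by rewrite exprn_even_gt0.
pose F := A - E; have EE : E = A - F by rewrite /F; ring.
have sF : s ^+ 2 * F ^+ 2 <= s * (F * b).
  have -> : s * (F * b) = (`|s| * `|F|) * `|b|.
    by rewrite -(ger0_norm sg) !normrM mulrA.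
  have -> : s ^+ 2 * F ^+ 2 = (`|s| * `|F|) * (`|s| * `|F|).
    by rewrite -normrM -expr2 real_normK ?num_real // exprMn.
  by rewrite ler_wpM2l // mulr_ge0.
have s4 : s ^+ 2 <= 4^-1.
  have -> : s ^+ 2 = `|s| ^+ 2 by rewrite real_normK ?num_real.
  by have := normr_ge0 s; nra.
have c1 : c <= 1 by nra.
have hC : c ^+ 2 = 1 - s ^+ 2 by lra.
rewrite -subr_gt0.
have -> : (c ^+ 2 * A + 2 * c * s * b + s ^+ 2 * E) ^+ 2 +
  (s ^+ 2 * A - 2 * c * s * b + c ^+ 2 * E) ^+ 2 - (A ^+ 2 + E ^+ 2) =
  2^-1 * (c * (c * (4 * s ^+ 2 * (4 * b ^+ 2 - F ^+ 2)) +
          8 * (1 - 2 * s ^+ 2) * (s * (F * b)))).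
  rewrite EE.
  have -> : (c ^+ 2 * A + 2 * c * s * b + s ^+ 2 * (A - F)) =
      A - s ^+ 2 * F + 2 * c * s * b.
    by rewrite hC; ring.
  have -> : (s ^+ 2 * A - 2 * c * s * b + c ^+ 2 * (A - F)) =
      A - F + s ^+ 2 * F - 2 * c * s * b.
    by rewrite hC; ring.
  rewrite [in RHS]mulrDr mulrA -expr2 hC.
  apply/eqP; rewrite -subr_eq0; apply/eqP.
  set X := _ - _.
  have -> : X = 8 * (c ^+ 2 - (1 - s ^+ 2)) * s ^+ 2 * b ^+ 2.
    by rewrite /X; field.
  by rewrite hC subrr; ring.
rewrite !pmulr_rgt0 ?invr_gt0 //.
set z := s * (F * b) in sg sF *.
have : 0 < c * (16 * s ^+ 2 * b ^+ 2).
  by do 2!apply: mulr_gt0 => //; apply: mulr_gt0.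
have Y0 : 0 <= s ^+ 2 * F ^+ 2 by rewrite -exprMn sqr_ge0.
have : c * (s ^+ 2 * F ^+ 2) <= z by apply: le_trans sF; rewrite ler_piMl.
have : 0 <= (4^-1 - s ^+ 2) * z by rewrite mulr_ge0 // subr_ge0.
lra.
Qed.

Lemma conj_rotE (R : realType) m (B : 'M[R]_m) p q c s :
  B = B^T -> (plane_rot p q c s)^T *m B *m plane_rot p q c s =
  (B *m plane_rot p q c s)^T *m plane_rot p q c s.
Proof. by move=> symB; rewrite trmx_mul -symB. Qed.

Lemma conj_rot_diag (R : realType) m (B : 'M[R]_m) p q c s i :
  p != q -> B = B^T ->
  ((plane_rot p q c s)^T *m B *m plane_rot p q c s) i i =
  if i == p then c ^+ 2 * B p p + 2 * c * s * B p q + s ^+ 2 * B q q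
  else if i == q then s ^+ 2 * B p p - 2 * c * s * B p q + c ^+ 2 * B q q
  else B i i.
Proof.
move=> pq symB; have Bqp : B q p = B p q by rewrite [in LHS]symB mxE.
have qp : (q == p) = false by rewrite eq_sym (negPf pq).
rewrite conj_rotE // mul_rot; have [/eqP ->|ip] := boolP (i == p).
  by rewrite ![_^T _ _]mxE !mul_rot !eqxx ?qp Bqp; ring.
have [/eqP ->|iq] := boolP (i == q).
  by rewrite ![_^T _ _]mxE !mul_rot !eqxx ?qp Bqp; ring.
by rewrite ![_^T _ _]mxE !mul_rot (negPf ip) (negPf iq).
Qed.

Lemma mul_rot_close (R : realType) m (A : 'M[R]_m) p q c s M i j :
  `|c - 1| <= `|s| -> (forall k l, `|A k l| <= M) ->
  `|(A *m plane_rot p q c s) i j - A i j| <= 2 * `|s| * M.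
Proof.
move=> hc hA; have M0 : 0 <= M := le_trans (normr_ge0 _) (hA i j).
have step u v : `|u| <= `|s| -> `|u * A i v| <= `|s| * M.
  by move=> hu; rewrite normrM ler_pM.
rewrite mul_rot; case: ifP => [/eqP ->|_]; last case: ifP => [/eqP ->|_].
- have -> : c * A i p + s * A i q - A i p = (c - 1) * A i p + s * A i q by ring.
  apply: le_trans (ler_normD _ _) _; have := step _ p hc.
  have := step s q (lexx _); lra.
- have -> : c * A i q - s * A i p - A i q =
      (c - 1) * A i q + - s * A i p by ring.
  apply: le_trans (ler_normD _ _) _; have := step _ q hc.
  have := step (- s) p; rewrite normrN => /(_ (lexx _)); lra.
by rewrite subrr normr0 !mulr_ge0.
Qed.

Lemma conj_rot_close (R : realType) m (B : 'M[R]_m) p q c s M i j :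
  B = B^T -> `|c - 1| <= `|s| -> `|s| <= 2^-1 -> (forall k l, `|B k l| <= M) ->
  `|((plane_rot p q c s)^T *m B *m plane_rot p q c s) i j - B i j|
    <= 6 * `|s| * M.
Proof.
move=> symB hc hs hB; have M0 : 0 <= M := le_trans (normr_ge0 _) (hB i j).
pose A := (B *m plane_rot p q c s)^T.
have sM : `|s| * M <= 2^-1 * M by rewrite ler_wpM2r.
have AB k l : `|A k l - B k l| <= 2 * `|s| * M.
  by rewrite /A [in B k l]symB ![_^T _ _]mxE; apply: mul_rot_close.
have hA k l : `|A k l| <= 2 * M.
  rewrite -[A k l](subrK (B k l)); apply: le_trans (ler_normD _ _) _.
  have := AB k l; have := hB k l; lra.
rewrite conj_rotE // -/A.
have -> : (A *m plane_rot p q c s) i j - B i j =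
  ((A *m plane_rot p q c s) i j - A i j) + (A i j - B i j) by ring.
apply: le_trans (ler_normD _ _) _.
have := AB i j; have := mul_rot_close p q i j hc hA; lra.
Qed.

(** By [calI_frobenius], the rotation changes the energy only through the
    diagonal entries at p and q, and with a negative coefficient. *)
Lemma calI_rot (R : realType) (a : R) m (B : 'M[R]_m) (U : {set 'I_m}) p q c s :
  2 < a -> B = B^T -> p != q -> c ^+ 2 + s ^+ 2 = 1 ->
  (p \in U) = (q \in U) ->
  let D := (plane_rot p q c s)^T *m B *m plane_rot p q c s in
  B p p ^+ 2 + B q q ^+ 2 < D p p ^+ 2 + D q q ^+ 2 ->
  calI a U D <= calI a U B /\ (p \in U -> calI a U D < calI a U B).
Proof.
move=> a2 symB pq cs pqU D spread.
have symD : D = D^T by rewrite /D !trmx_mul trmxK -symB mulmxA.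
have k0 : a^-1 - 2^-1 < 0.
  by rewrite subr_lt0 ltf_pV2 ?posrE //; lra.
rewrite !calI_frobenius // frobenius_rot // lerD2l ltrD2l.
rewrite (ler_nM2l k0) (ltr_nM2l k0).
have rest i : i != p -> i != q -> D i i = B i i.
  by move=> ip iq; rewrite conj_rot_diag // (negPf ip) (negPf iq).
have [pU|pU] := boolP (p \in U).
  have qp : q != p by rewrite eq_sym.
  suff lt : \sum_(i in U) B i i ^+ 2 < \sum_(i in U) D i i ^+ 2.
    by split=> //; apply: ltW.
  rewrite (bigD1 p) //= (bigD1 q) /= -?pqU ?pU //.
  rewrite [ltRHS](bigD1 p) //= [X in _ < _ + X](bigD1 q) /= -?pqU ?pU //.
  rewrite !addrA [X in _ < _ + X](eq_bigr (fun i => B i i ^+ 2)) ?ltrD2r //.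
  by move=> i /andP [/andP [_ ip] iq]; rewrite rest.
split=> //; rewrite le_eqVlt; apply/orP; left; apply/eqP/eq_bigr => i iU.
rewrite rest //; first by apply: contraNneq pU => <-.
by rewrite pqU in pU; apply: contraNneq pU => <-.
Qed.

(** * Tight sets separate the indices *)

(** Otherwise B_pq <> 0 by [inseparable_offdiag_neq0].  Rotate both B and x by a
    small angle in the plane of p and q: the Rayleigh quotient is unchanged,
    every tight set contains both or neither of p and q, and those containing
    them become slack.  The rotated pair is extremal and p belongs to no tight
    set, against [extremal_covered]. *)
Lemma tight_separates (R : realType) (a g : R) m (B : 'M[R]_m) x p q :
  2 < a -> extremal a g B x -> p != q ->
  exists2 U, tight a B U & (p \in U) != (q \in U).
Proof.
move=> a2 ext pq; have a0 : 0 < a by lra.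
case: (boolP [exists U, tight a B U && ((p \in U) != (q \in U))]).
  by move=> /existsP [U /andP [tU pU]]; exists U.
rewrite negb_exists => /forallP h; exfalso.
have insep U : tight a B U -> (p \in U) = (q \in U).
  by move=> tU; have := h U; rewrite tU /= negbK => /eqP.
have b0 := inseparable_offdiag_neq0 a0 ext pq insep.
have [KB x0 Bx top] := ext; have [symB _] := KB.
have [d d0 hd] := slack_open a0 symB.
pose M := 1 + \sum_k \sum_l `|B k l|.
have hM k l : `|B k l| <= M.
  by apply: le_trans (abs_entry_le_sum B k l) _; rewrite lerDr.
have M1 : 1 <= M.
  by rewrite lerDl; apply: sumr_ge0 => i _; apply: sumr_ge0.
pose b := B p q; pose F := B p p - B q q.
have nb0 : 0 < `|b| by rewrite normr_gt0.
pose o := Num.min (Num.min 1 d) `|b| / (6 * M).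
have M6 : 0 < 6 * M by lra.
have oE : o * (6 * M) = Num.min (Num.min 1 d) `|b| by rewrite divfK // gt_eqF.
have [o1 od ob] : [/\ o * (6 * M) <= 1, o * (6 * M) <= d & o * (6 * M) <= `|b|].
  by rewrite oE; split; rewrite !ge_min lexx ?orbT.
have o0 : 0 < o by rewrite divr_gt0 // !lt_min ltr01 d0.
have oh : o <= 2^-1.
  have : o * 6 <= o * (6 * M) by rewrite ler_pM2l //; lra.
  lra.
(* of the two directions of rotation, the one in which the diagonal spreads *)
pose s := if 0 <= F * b then o else - o.
have ns : `|s| = o by rewrite /s; case: ifP => _; rewrite ?normrN gtr0_norm.
have s2 : s ^+ 2 = o ^+ 2 by rewrite /s; case: ifP => _; rewrite ?sqrrN.
have sg : 0 <= s * (F * b).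
  rewrite /s; case: ifP => hF; first by rewrite mulr_ge0 // ltW.
  rewrite mulNr -mulrN mulr_ge0 ?oppr_ge0 //; first exact: ltW.
  by rewrite ltW // ltNge hF.
have o2 : o ^+ 2 <= o by rewrite expr2 ler_piMl ?ltW //; lra.
pose c := Num.sqrt (1 - o ^+ 2).
have c2 : c ^+ 2 = 1 - o ^+ 2 by rewrite sqr_sqrtr //; lra.
have cge0 : 0 <= c by apply: sqrtr_ge0.
have c0 : 0 < c by rewrite sqrtr_gt0; lra.
have cs : c ^+ 2 + s ^+ 2 = 1 by rewrite c2 s2 subrK.
have hc : `|c - 1| <= `|s|.
  by rewrite ns ler_norml; apply/andP; split; nra.
have hF : `|s| * `|F| <= `|b|.
  apply: le_trans ob; rewrite ns ler_pM2l //.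
  apply: le_trans (ler_normB _ _) _; have := hM p p; have := hM q q; lra.
pose Q : 'M[R]_m := plane_rot p q c s; pose D := Q^T *m B *m Q.
have QQ : Q *m Q^T = 1%:M by apply: mulmx1C; apply: rot_orthogonal.
have symD : D = D^T by rewrite /D !trmx_mul trmxK -symB mulmxA.
have spread : B p p ^+ 2 + B q q ^+ 2 < D p p ^+ 2 + D q q ^+ 2.
  rewrite !conj_rot_diag // !eqxx [q == p]eq_sym (negPf pq).
  apply: spread_diagonal => //; first by rewrite -normr_gt0 ns.
  by rewrite ns.
have closeD i j : `|D i j - B i j| <= d.
  apply: le_trans (conj_rot_close p q i j symB hc _ hM) _; rewrite ns //.
  by apply: le_trans od; rewrite [6 * o]mulrC mulrA.
have ID U : tight a B U ->
    calI a U D <= calI a U B /\ (p \in U -> calI a U D < calI a U B).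
  by move=> tU; apply: calI_rot => //; apply: insep.
have KD : calK m a D.
  split=> // U _; have [tU|nt] := boolP (tight a B U).
    by rewrite -(eqP tU); case: (ID U tU).
  by apply/ltW/hd => //; apply: not_tight.
have nQ : sqnorm (x *m Q) = sqnorm x.
  by rewrite /sqnorm trmx_mul mulmxA -[x *m Q *m _]mulmxA QQ mulmx1.
have qD : qform D (x *m Q) = qform B x.
  rewrite /qform /D trmx_mul !mulmxA -[x *m Q *m _]mulmxA QQ mulmx1.
  by rewrite -[_ *m Q *m _]mulmxA QQ mulmx1.
have extD : extremal a g D (x *m Q).
  split=> //; last by rewrite qD nQ.
  by apply: contra x0 => /eqP xQ; apply/eqP/sqnorm_eq0; rewrite -nQ xQ
    /sqnorm mul0mx mxE.
have [U tU pU] := extremal_covered p a0 extD.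
have [tB|nt] := boolP (tight a B U).
  by have [_ /(_ pU)] := ID U tB; rewrite (eqP tU) (eqP tB) ltxx.
by have := hd D symD closeD U (not_tight KB nt); rewrite (eqP tU) ltxx.
Qed.

(** * From a separating lattice of sets to a chain *)

(** A nonempty member V exceeds a maximal proper submember W by one point only:
    if p and q were two points of V outside W, a member S separating them
    would give W :|: (S :&: V), strictly between W and V.  Points are thus
    removed one at a time from the full set. *)
Lemma separating_lattice_chain (T : finType) (P : pred {set T}) :
  P finset.set0 -> P [set: T] ->
  (forall U V, P U -> P V -> P (U :|: V)) ->
  (forall U V, P U -> P V -> P (U :&: V)) ->
  (forall p q, p != q -> exists2 U, P U & (p \in U) != (q \in U)) ->
  exists s : seq T, [/\ uniq s, size s = #|T| &
    forall r, P [set x in take r s]].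
Proof.
move=> P0 PT PU PI sep.
suff main n (V : {set T}) : #|V| = n -> P V ->
    exists s : seq T, [/\ uniq s, [set x in s] = V &
      forall r, P [set x in take r s]].
  have [s [us sT Ps]] := main _ _ erefl PT.
  exists s; split=> //; rewrite -cardsT -sT cardsE; exact/esym/card_uniqP.
elim: n V => [|n IHn] V cV PV.
  exists [::]; split=> //.
    by rewrite (cards0_eq cV); apply/setP => x; rewrite !inE.
pose C (W : {set T}) := P W && (W \proper V).
have C0 : C finset.set0.
  by rewrite /C P0 proper0 -card_gt0 cV.
case: (arg_maxnP (fun W : {set T} => #|W|) C0) => W /andP [PW WV] maxW.
have [sWV /set0Pn [p pD]] : W \subset V /\ V :\: W != finset.set0.
  by move: WV; rewrite properE => /andP [-> ]; rewrite finset.setD_eq0.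
have [pV pW] : p \in V /\ p \notin W by move: pD; rewrite inE => /andP [].
have VW : V = p |: W.
  apply/eqP; rewrite finset.eqEsubset andbC finset.subUset.
  rewrite finset.sub1set pV sWV /=.
  apply/fintype.subsetP => q qV; rewrite !inE; case: eqVneq => //= qp.
  apply: contraT => qW; have [S PS Spq] := sep _ _ qp.
  pose X := W :|: (S :&: V).
  have XV : X \subset V by rewrite finset.subUset sWV finset.subsetIr.
  have CX : C X.
    rewrite /C PU ?PI //= finset.properEneq XV andbT.
    apply: contra Spq => /eqP XE.
    move: pV qV; rewrite -{1 2}XE !inE (negPf pW) (negPf qW) /=.
    by move=> /andP [-> _] /andP [-> _].
  have le : (#|X| <= #|W|)%N := maxW X CX.
  move: le; rewrite leqNgt => /negP []; apply: proper_card.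
  rewrite properE finset.subsetUl /=; apply/negP => XW.
  have notin z : z \in V -> z \notin W -> z \notin S.
    move=> zV; apply: contra => zS; apply: (fintype.subsetP XW).
    by rewrite !inE zS zV orbT.
  by move: Spq; rewrite (negPf (notin _ pV pW)) (negPf (notin _ qV qW)).
have cW : #|W| = n by move: cV; rewrite VW cardsU1 pW => -[].
have [s [us sW Ps]] := IHn W cW PW.
have ps : p \notin s by move: pW; rewrite -sW inE.
have sV : [set x in rcons s p] = V.
  by rewrite VW -sW; apply/setP => z; rewrite !inE mem_rcons inE.
exists (rcons s p); split=> //; first by rewrite rcons_uniq ps.
move=> r; have [rs|rs] := leqP r (size s).
  by rewrite -cats1 takel_cat.
by rewrite take_oversize ?size_rcons // sV.
Qed.

Theorem proposition2 (R : realType) (a : R) (m : nat) (B : 'M[R]_m)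
    (ha : 2 < a) (hm : (1 <= m)%N)
    (hB : calK m a B) (hmax : lambda_max B = gamma m a) :
  exists pi : 'S_m, forall r : nat, (1 <= r <= m)%N ->
    calI a (prefix_set pi r) B = r%:R.
Proof.
have a0 : 0 < a by lra.
have [symB _] := hB.
have [/eigenvalueP [x xB x0] _] := lambda_maxP hm symB.
have ext : extremal a (gamma m a) B x.
  split=> //; first by rewrite /qform xB -scalemxAl mxE hmax.
  by move=> D KD; apply: qform_le_gamma.
have tU U V (tU : tight a B U) (tV : tight a B V) := tightUI a0 hB tU tV.
have tT : tight a B [set: 'I_m].
  pose Y := \bigcup_(U | tight a B U) U.
  suff <- : Y = [set: 'I_m].
    rewrite /Y; elim/big_ind: _ => [|U V tU1 tV|//]; first exact: tight0.
    by case: (tU _ _ tU1 tV).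
  apply/setP => p; rewrite inE; apply/bigcupP.
  by have [U tU1 pU] := extremal_covered p a0 ext; exists U.
have [s [us ss Ps]] := @separating_lattice_chain _ (fun U => tight a B U)
  (tight0 a B) tT (fun U V h1 h2 => (tU U V h1 h2).1)
  (fun U V h1 h2 => (tU U V h1 h2).2)
  (fun p q pq => tight_separates ha ext pq).
rewrite card_ord in ss; pose f (k : 'I_m) := nth k s k.
have nths (k : 'I_m) : f k = nth (Ordinal hm) s k.
  by apply: set_nth_default; rewrite ss.
have finj : injective f.
  move=> k l; rewrite !nths => /eqP; rewrite nth_uniq ?ss //.
  by move/eqP/val_inj.
exists (perm finj) => r /andP [r1 rm].
have -> : prefix_set (perm finj) r = [set x in take r s].
  apply/setP => z; rewrite inE; apply/imsetP/idP.
    move=> [k]; rewrite inE => kr ->; rewrite permE nths.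
    by rewrite -(nth_take _ kr) mem_nth // size_take_min ss leq_min kr ltn_ord.
  move=> /(nthP (Ordinal hm)) [k]; rewrite size_take_min ss leq_min.
  move=> /andP [kr km] <-; exists (Ordinal km); first by rewrite inE.
  by rewrite permE nths nth_take.
rewrite (eqP (Ps r)); congr (_%:R).
by rewrite cardsE (card_uniqP (take_uniq _ us)) size_takel ?ss.
Qed.
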